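(* Let $G$ be a $\Delta$-regular graph on $n$ vertices. Every minimum maximal matching of $G$ leaves at most $\lfloor (\Delta-1)n/(2\Delta-1) \rfloor$ at-risk vertices, and if a minimum maximal matching leaves at most $2^\Delta - 1$ at-risk vertices, then $\gamma(G) \le \gamma_e(G)$. In particular, $\gamma(G) \le \gamma_e(G)$ for every $4$-regular graph on at most $37$ vertices, every $5$-regular graph on at most $70$ vertices, and every $6$-regular graph on at most $140$ vertices.
   Context: Graphs are finite, simple and undirected. A graph is $\Delta$-regular if every vertex has exactly $\Delta$ neighbours. The domination number $\gamma(G)$ is the minimum size of a set $S$ of vertices such that every vertex outside $S$ has a neighbour in $S$. A matching is a set of edges no two of which share a vertex; it is maximal if no edge of $G$ can be added to it. The edge domination number $\gamma_e(G)$ is the minimum size of a maximal matching, and a minimum maximal matching is a maximal matching of that size. Given a maximal matching $M$ of a $\Delta$-regular graph, a vertex not lying on any edge of $M$ is unsaturated; an unsaturated vertex is at risk (with respect to $M$) if its $\Delta$ neighbours lie on $\Delta$ distinct edges of $M$. ''$M$ leaves $r$ at-risk vertices'' means there are exactly $r$ vertices at risk with respect to $M$. *)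

(* Defs.v *)
From mathcomp Require Export all_boot all_order all_algebra.
Set Implicit Arguments.
Unset Strict Implicit.
Unset Printing Implicit Defensive.

Record sgraph := SGraph {
  vertex :> finType;
  adj : rel vertex;
  adj_sym : symmetric adj;
  adj_irrefl : irreflexive adj }.

Definition neighbours (G : sgraph) (x : G) : {set G} := [set y | adj x y].

Definition regular (G : sgraph) (D : nat) : Prop :=
  forall x : G, #|neighbours x| = D.

Definition dominating (G : sgraph) (S : {set G}) : bool :=
  [forall x in ~: S, [exists y in S, adj x y]].

Definition domination_number (G : sgraph) : nat :=
  #|[arg min_(S < [set: G] | dominating S) #|S|]|.

(* Edges are two-element vertex sets, as [adj] is irreflexive. *)
Definition edges (G : sgraph) : {set {set G}} :=
  [set [set p.1; p.2] | p : G * G & adj p.1 p.2].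

Definition matching (G : sgraph) (M : {set {set G}}) : bool :=
  (M \subset edges G) && trivIset M.

Definition maximal_matching (G : sgraph) (M : {set {set G}}) : bool :=
  matching M && [forall f in edges G :\: M, ~~ matching (f |: M)].

Lemma ex_maximal_matching (G : sgraph) :
  exists M : {set {set G}}, maximal_matching M.
Proof.
have m0 : matching (set0 : {set {set G}}).
  by rewrite /matching sub0set; apply/trivIsetP => A B; rewrite inE.
have [M /maxsetP [mM maxM] _] := maxset_exists m0.
exists M; rewrite /maximal_matching mM; apply/forall_inP => f.
rewrite inE => /andP [fM _]; apply/negP => mfM.
by move: fM; rewrite -(maxM _ mfM (subsetU1 f M)) setU11.
Qed.

(* The default value [set0] of the arg min need not be a maximal matching; it is
   never used, by [ex_maximal_matching]. *)
Definition edge_domination_number (G : sgraph) : nat :=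
  #|[arg min_(M < set0 | @maximal_matching G M) #|M|]|.

Definition minimum_maximal_matching (G : sgraph) (M : {set {set G}}) : bool :=
  maximal_matching M && (#|M| == edge_domination_number G).

Definition unsaturated (G : sgraph) (M : {set {set G}}) : {set G} :=
  ~: cover M.

(* For a matching M each neighbour lies on at most one edge of M, so the number
   of edges met equals the degree iff no two neighbours lie on the same edge. *)
Definition at_risk (G : sgraph) (M : {set {set G}}) : {set G} :=
  [set x in unsaturated M |
    (neighbours x \subset cover M) &&
    (#|[set f in M | f :&: neighbours x != set0]| == #|neighbours x|)].

(* Main.v *)
(** Let M be a maximal matching. The unsaturated vertices form an independent
    set, and every saturated vertex spends one of its D incident edges on M, so
    double counting the edges leaving the unsaturated set bounds its size, hence
    the number of at-risk vertices. For the domination number, pick one end of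
    every edge of M at random: the resulting set dominates everything except
    possibly some at-risk vertices, each of which is missed with probability
    2^-D. With fewer than 2^D at-risk vertices some choice misses none. *)
Require Import Defs.
From mathcomp Require Import zify ring.
Set Implicit Arguments.
Unset Strict Implicit.
Unset Printing Implicit Defensive.
Import Order.TTheory GRing.Theory Num.Theory.

(** Once its trace on [F] is fixed, [A] is determined by [A :\: F], a subset of [M :\: F]. *)
Lemma card_trace_fiber (T : finType) (M F B : {set T}) :
  F \subset M -> #|[set A in powerset M | A :&: F == B]| <= 2 ^ (#|M| - #|F|).
Proof.
move=> sFM; have <- : #|M :\: F| = #|M| - #|F| by rewrite cardsD (setIidPr sFM).
rewrite -card_powerset; set X := [set _ in _ | _].
have injD : {in X &, injective (fun A : {set T} => A :\: F)}.
  move=> A A'; rewrite !inE => /andP [_ /eqP AF] /andP [_ /eqP A'F] eqD.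
  by rewrite -(setID A F) -(setID A' F) AF A'F eqD.
rewrite -(card_in_imset injD); apply/subset_leq_card/subsetP => _ /imsetP [A AX ->].
by move: AX; rewrite !inE => /andP [sAM _]; apply: setSD.
Qed.

(* First-moment argument: a uniformly random subset of M has trace B i on F i
   with probability at most 2 ^- k. *)
Lemma exists_subset_avoiding_traces (T I : finType) (M : {set T})
    (R : {set I}) (F B : I -> {set T}) (k : nat) :
    (forall i, i \in R -> F i \subset M /\ #|F i| = k) -> #|R| < 2 ^ k ->
  exists2 A : {set T}, A \subset M & forall i, i \in R -> A :&: F i != B i.
Proof.
move=> FP ltR; have [R0|[i0 i0R]] := set_0Vmem R.
  by exists set0; rewrite ?sub0set // => i; rewrite R0 inE.
have lekM : k <= #|M| by have [sFM <-] := FP _ i0R; apply: subset_leq_card.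
pose bad i := [set A in powerset M | A :&: F i == B i].
have ltbad : #|\bigcup_(i in R) bad i| < #|powerset M|.
  have le1 : #|\bigcup_(i in R) bad i| <= \sum_(i in R) #|bad i|.
    apply: (big_ind2 (fun (X : {set {set T}}) n => #|X| <= n)) => //.
      by rewrite cards0.
    move=> X m Y n leX leY.
    by rewrite (leq_trans (leq_card_setU _ _)) // leq_add.
  apply: leq_ltn_trans le1 _.
  apply: (@leq_ltn_trans (\sum_(i in R) 2 ^ (#|M| - k))).
    by apply: leq_sum => i /FP [sFM <-]; apply: card_trace_fiber.
  by rewrite sum_nat_const card_powerset -{2}(subnKC lekM) expnD ltn_pmul2r ?expn_gt0.
have /subsetPn [A AM Agood] : ~~ (powerset M \subset \bigcup_(i in R) bad i).
  by apply: contraL ltbad => /subset_leq_card; rewrite -leqNgt.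
exists A => [|i iR]; first by rewrite powersetE in AM.
by apply: contra Agood => eqA; apply/bigcupP; exists i; rewrite // inE AM.
Qed.

Lemma edgesP (G : sgraph) (f : {set G}) :
  reflect (exists x y, adj x y /\ f = [set x; y]) (f \in edges G).
Proof.
apply: (iffP imsetP) => [[[x y] xy ->]|[x [y [xy ->]]]].
  by exists x, y; rewrite inE in xy.
by exists (x, y); rewrite ?inE.
Qed.

Lemma domination_number_le (G : sgraph) (S : {set G}) :
  dominating S -> domination_number G <= #|S|.
Proof.
move=> domS; rewrite /domination_number; case: arg_minnP => [|T _ minT].
  by apply/forall_inP => x; rewrite !inE.
exact: minT.
Qed.

Lemma ex_minimum_maximal_matching (G : sgraph) :
  exists M : {set {set G}}, minimum_maximal_matching M.
Proof.
have [M0 maxM0] := ex_maximal_matching G.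
rewrite /minimum_maximal_matching /edge_domination_number /arg_min /extremum.
(* The default [set0] would be returned only if no maximal matching had least size; minimising from
   [M0] rules this out. *)
case: pickP => [M /andP [maxM _]|noM]; first by exists M; rewrite maxM /=.
have [M maxM minM] := arg_minnP (fun M : {set {set G}} => #|M|) maxM0.
by have /negP [] := negbT (noM M); rewrite /= maxM; apply/forall_inP.
Qed.

Section MaximalMatching.

Variables (G : sgraph) (M : {set {set G}}).
Hypothesis maxM : maximal_matching M.

Lemma maximal_matching_edge f : f \in M -> f \in edges G.
Proof. by case/andP: maxM => /andP [/subsetP sME _] _; apply: sME. Qed.

(** An edge with two unsaturated ends would be disjoint from every edge of [M], so it could be added
    to [M]. *)
Lemma unsaturated_neighbours x :
  x \in unsaturated M -> neighbours x \subset cover M.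
Proof.
rewrite inE => xM; apply/subsetP => y; rewrite inE => xy.
apply: contraT => yM; case/andP: maxM => /andP [sME trivM] /forall_inP max.
have fE : [set x; y] \in edges G by apply/edgesP; exists x, y.
have disj f : f \in M -> [disjoint [set x; y] & f].
  move=> fM; apply/pred0P => z; apply/negbTE; rewrite /= !inE.
  apply/negP => /andP [zxy zf].
  have zM : z \in cover M by apply/bigcupP; exists f.
  by case/orP: zxy zM => /eqP ->; apply/negP.
have fM : [set x; y] \notin M.
  apply: contra xM => fM; apply/bigcupP; exists [set x; y] => //.
  by rewrite !inE eqxx.
have /negP [] : ~~ matching ([set x; y] |: M) by apply: max; rewrite inE fM fE.
rewrite /matching subUset sub1set fE sME /=; apply/trivIsetP => f g.
move/trivIsetP: trivM => trivM; rewrite !inE.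
case/predU1P => [->|fM']; case/predU1P => [->|gM'] //; rewrite ?eqxx //.
- by move=> _; apply: disj.
- by move=> _; rewrite disjoint_sym; apply: disj.
- exact: trivM.
Qed.

Lemma saturated_partner y : y \in cover M -> exists2 z, z \in cover M & adj y z.
Proof.
case/bigcupP => f fM yf; have /edgesP [a [b [ab fE]]] := maximal_matching_edge fM.
have inM z : z \in f -> z \in cover M by move=> zf; apply/bigcupP; exists f.
move: yf; rewrite {1}fE !inE => /orP [] /eqP ->.
  by exists b; rewrite // inM // fE !inE eqxx orbT.
by exists a; rewrite 1?adj_sym // inM // fE !inE eqxx.
Qed.

(** Writing the degree as [D.+1] turns the factors $\Delta-1$ and $2\Delta-1$ into [D] and
    [D.*2.+1], without truncated subtraction. *)
Lemma card_unsaturated_bound (D : nat) :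
  regular G D.+1 -> D.*2.+1 * #|unsaturated M| <= D * #|G|.
Proof.
move=> regG.
have count : D.+1 * #|unsaturated M| <= D * #|cover M|.
  rewrite !(mulnC _ #|_|) -!sum_nat_const.
  have -> : \sum_(x in unsaturated M) D.+1
          = \sum_(x in unsaturated M) \sum_(y in cover M) adj x y.
    apply: eq_bigr => x xU; rewrite -(regG x) -big_mkcondr sum1dep_card.
    apply: eq_card => y; rewrite !inE andbC; case xy: (adj x y) => //=.
    by rewrite (subsetP (unsaturated_neighbours xU)) // inE.
  rewrite exchange_big; apply: leq_sum => y /saturated_partner [z zM yz].
  (* The partner [z] is a saturated neighbour of [y], so at most [D] of its [D.+1] neighbours are
     unsaturated. *)
  rewrite -big_mkcondr sum1dep_card -ltnS -(regG y); apply: proper_card.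
  apply/properP; split; last by exists z; rewrite !inE ?zM.
  by apply/subsetP => x; rewrite !inE adj_sym => /andP [].
have := cardsC (cover M); rewrite -/(unsaturated M); nia.
Qed.

Lemma at_risk_bound (D : nat) :
  regular G D.+1 -> D.*2.+1 * #|at_risk M| <= D * #|G|.
Proof.
move=> /card_unsaturated_bound; apply: leq_trans; rewrite leq_mul2l /=.
by apply/subset_leq_card/subsetP => x; rewrite inE => /andP [].
Qed.

Lemma domination_number_le_matching (D : nat) :
  regular G D -> #|at_risk M| < 2 ^ D -> domination_number G <= #|M|.
Proof.
move=> regG ltR; have [x0 _|G0] := pickP G; last first.
  apply: (@leq_trans 0) => //; rewrite -(cards0 G); apply: domination_number_le.
  by apply/forall_inP => x; have := G0 x.
(* Orient every edge of [M]; the pair [(x0, x0)] is a dummy value off [M]. *)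
have /fin_all_exists [e eP] (f : {set G}) : exists p : G * G,
    f \in M -> adj p.1 p.2 /\ f = [set p.1; p.2].
  have [/maximal_matching_edge /edgesP [a [b ab]]|_] := boolP (f \in M).
    by exists (a, b).
  by exists (x0, x0).
pose F x := [set f in M | f :&: neighbours x != set0].
have FP x : x \in at_risk M -> F x \subset M /\ #|F x| = D.
  rewrite inE => /and3P [_ _ /eqP cardF]; rewrite cardF; split=> //.
  by apply/subsetP => f; rewrite inE => /andP [].
(* [A] collects the edges whose first end is chosen. The trace to avoid at an at-risk [x] is the one
   for which every edge of [F x] has its end outside [neighbours x] chosen. *)
have [A sAM Agood] := exists_subset_avoiding_traces
  (fun x => [set f in F x | (e f).1 \notin neighbours x]) FP ltR.
pose pt f := if f \in A then (e f).1 else (e f).2.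
apply: leq_trans (leq_imset_card pt M); apply: domination_number_le.
apply/forall_inP => x; rewrite inE => xS.
apply: contraT => /exists_inPn undom.
have {}undom f : f \in M -> pt f \notin neighbours x.
  by move=> fM; rewrite inE undom // imset_f.
pose other f := if f \in A then (e f).2 else (e f).1.
have fE f : f \in M -> f = [set pt f; other f].
  by move=> /eP [_ {1}->]; rewrite /pt /other; case: ifP; rewrite // setUC.
have ptA f : f \in M -> adj (pt f) (other f).
  by move=> /eP [ef _]; rewrite /pt /other; case: ifP; rewrite // adj_sym.
(* A saturated [x] that is not chosen is the other end of its edge, hence adjacent to the chosen
   end. *)
have xU : x \in unsaturated M.
  rewrite inE; apply/negP => /bigcupP [f fM]; rewrite (fE f fM) !inE.
  case/orP => /eqP xf; first by rewrite xf imset_f in xS.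
  by have := undom f fM; rewrite inE xf adj_sym ptA.
have sNM := unsaturated_neighbours xU.
(* No chosen end is a neighbour of [x], so each edge of [F x] meets [neighbours x] in its other end
   alone. As edges of [M] are disjoint, [other] is injective, and [x] is at risk. *)
have NE : neighbours x = other @: F x.
  apply/setP => y; apply/idP/imsetP => [yN|[f]].
    have /bigcupP [f fM yf] := subsetP sNM y yN.
    exists f; first by rewrite inE fM; apply/set0Pn; exists y; rewrite inE yf.
    move: yf; rewrite {1}(fE f fM) !inE => /orP [] /eqP // yf.
    by have := undom f fM; rewrite -yf yN.
  rewrite inE => /andP [fM /set0Pn [z]]; rewrite inE => /andP [zf zN] ->.
  move: zf; rewrite {1}(fE f fM) => /set2P [] zE; last by rewrite -zE.
  by have := undom f fM; rewrite -zE zN.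
have trivM : trivIset M by case/andP: maxM => /andP [].
have inj_other : {in F x &, injective other}.
  apply: (can_in_inj (g := pblock M)) => f; rewrite inE => /andP [fM _].
  by apply: def_pblock => //; rewrite {2}(fE f fM) !inE eqxx orbT.
have xR : x \in at_risk M.
  by rewrite inE xU sNM /= {2}NE card_in_imset.
(* An edge of [F x] lies in [A] exactly when its first end is not a neighbour of [x]: this is the
   avoided trace. *)
have /negP [] := Agood x xR; apply/eqP/setP => f; rewrite [LHS]inE [RHS]inE.
rewrite andbC; case fF: (f \in F x) => //=.
have fM : f \in M by move: fF; rewrite inE => /andP [].
have := undom f fM; have : other f \in neighbours x by rewrite NE imset_f.
by rewrite /pt /other; case: ifP => _ => [_ ->|->].
Qed.

End MaximalMatching.

Theorem proposition9 :
  (forall (G : sgraph) (D : nat), regular G D ->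
     (forall M : {set {set G}}, minimum_maximal_matching M ->
        (#|at_risk M|%:Z <=
           Num.floor ((D%:Q - 1) * #|G|%:Q / (2 * D%:Q - 1) : rat))%R) /\
     (forall M : {set {set G}}, minimum_maximal_matching M ->
        #|at_risk M| <= 2 ^ D - 1 ->
        domination_number G <= edge_domination_number G)) /\
  (forall G : sgraph, regular G 4 -> #|G| <= 37 ->
     domination_number G <= edge_domination_number G) /\
  (forall G : sgraph, regular G 5 -> #|G| <= 70 ->
     domination_number G <= edge_domination_number G) /\
  (forall G : sgraph, regular G 6 -> #|G| <= 140 ->
     domination_number G <= edge_domination_number G).
Proof.
have dom (G : sgraph) D (M : {set {set G}}) : regular G D ->
    minimum_maximal_matching M -> #|at_risk M| <= 2 ^ D - 1 ->
    domination_number G <= edge_domination_number G.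
  move=> regG /andP [maxM /eqP <-] leR.
  apply: (domination_number_le_matching maxM regG).
  by rewrite -(subnK (expn_gt0 2 D : 0 < 2 ^ D)) addn1 ltnS.
have dom_small D N (G : sgraph) :
    D * N < D.*2.+1 * 2 ^ D.+1 -> regular G D.+1 -> #|G| <= N ->
    domination_number G <= edge_domination_number G.
  move=> ltN regG leG; have [M minM] := ex_minimum_maximal_matching G.
  have /andP [maxM _] := minM; apply: (dom _ _ _ regG minM).
  have leR := leq_trans (at_risk_bound maxM regG) (leq_mul (leqnn D) leG).
  have := leq_ltn_trans leR ltN; rewrite ltn_pmul2l // => ltR.
  by rewrite -ltnS subn1 prednK // expn_gt0.
split; last first.
  (* The numerical conditions are 3*37 = 111 < 112 = 7*16, 4*70 = 280 < 288 = 9*32 and 5*140 = 700 <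
     704 = 11*64. *)
  by split; [|split] => G; apply: dom_small.
move=> G D regG; split=> M minM; last exact: dom regG minM.
rewrite floor_ge_int.
(* In degree 0 the denominator is -1 and the quotient is the number of vertices; in positive degree
   the denominator is positive and can be cleared. *)
case: D regG => [|D] regG.
  rewrite mulr0 !sub0r mulN1r divrNN divr1 ler_int lez_nat.
  exact: max_card.
have /andP [maxM _] := minM; have := at_risk_bound maxM regG.
have -> : (2 * (D.+1)%:Q - 1 = (D.*2.+1)%:Q)%R.
  by rewrite -muln2 !intS PoszM !intrD intrM; ring.
have -> : ((D.+1)%:Q - 1 = D%:Q)%R by rewrite intS intrD; ring.
rewrite ler_pdivlMr ?ltr0n // -!intrM ler_int.
nia.
Qed.
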